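(* There exists an absolute constant $K>0$ such that for all integers $d\ge 1$ and $n \ge 1$, every connected $d$-regular graph on $n$ vertices has a tour of length at most $\left(1+\frac{K}{d}\right) n$.
   Context: Graphs are finite and simple. A tour of a graph is a sequence of vertices in which consecutive vertices are adjacent, which ends at its starting vertex and visits every vertex of the graph at least once (i.e. a closed walk visiting all vertices); its length is the number of steps (edge traversals, counted with multiplicity). *)

(* Defs.v *)
From HB Require Import structures.
From mathcomp Require Import all_boot all_order all_algebra.
From mathcomp Require Import reals.

Set Implicit Arguments.
Unset Strict Implicit.
Unset Printing Implicit Defensive.

Section Graphs.
Variables (V : finType) (e : rel V).

Definition simple_graph : Prop := symmetric e /\ irreflexive e.

(* The empty graph would count as connected here. *)
Definition connected_graph : Prop := forall x y : V, connect e x y.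

Definition regular_graph (d : nat) : Prop :=
  forall x : V, #|[set y | e x y]| = d.

(* The sequence of vertices of the tour is x :: p, so that its length, the
   number of steps, is [size p]. *)
Definition is_tour (x : V) (p : seq V) : Prop :=
  [/\ path e x p, last x p = x & forall v : V, v \in x :: p].

End Graphs.

(* Main.v *)
Require Import Defs.
From HB Require Import structures.
From mathcomp Require Import all_boot all_order all_algebra.
From mathcomp Require Import reals.
From mathcomp Require Import zify.

Set Implicit Arguments.
Unset Strict Implicit.
Unset Printing Implicit Defensive.
Import Order.TTheory GRing.Theory Num.Theory.

(** The proof has two halves: a [d]-regular graph on [n] vertices has a spanning
    linear forest with at most [4 * n / d] components, and in a connected graph
    such a forest extends to a short tour.

    Linear forest.  Let [F] be a linear forest with as many edges as possible.
    Think of a vertex of degree [2 - j] in [F] as carrying [j] tokens; there are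
    two tokens per component.  A Posa rotation moves one token: if [u] carries
    a token and [u x] is an edge of the graph, add [u x] to [F] and delete an
    edge [x y] of [F]; the token moves from [u] to [y].  A token may also be
    frozen, that is, excluded from rotations; the function [c] counts the frozen
    tokens.  Let [W] be the set of vertices that can receive a token in some
    sequence of rotations, and [m] the number of tokens that are not frozen.
    The claim is [m * d <= 8 * #|W|] ([total_tokens_le]); with nothing frozen it
    bounds the number of components.  Consider a counterexample with [#|W|]
    minimal.

    - [concentrate]: for [R] smaller than [W], move the tokens so that as few
      as possible lie in [R], and freeze the others.  No token of [R] can leave
      [R] any more, so minimality bounds the number of tokens in [R].  Taking
      for [R] the part of [W] outside the neighbourhood of [x], one sees that
      tokens can be gathered next to [x] if [x] has many neighbours in [W].
    - If two tokens are next to [x], then [x] is not an end of a path of [F],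
      as [F] is maximum, and both [F]-neighbours of [x] can receive one of the
      tokens ([tokens_near_end], [tokens_near_internal]).  Two tokens are needed
      because deleting one of the two edges at [x] may close a cycle, but it
      cannot do so for both tokens: a component of a linear forest has only two
      ends ([three_ends]).
    - Hence a vertex outside [W] with more than [d / 2] neighbours in [W] has
      both [F]-neighbours in [W] ([degree_outside]), and a vertex of [W] has at
      most [d / 4] neighbours in [W] ([degree_inside]).  The vertices without
      [F]-neighbours in [W] cause only a small error ([outer0_nbhd],
      [inner0_nbhd]).
    - Summing, [2 * d * #|W|], which is twice the number of pairs of adjacent
      vertices the second of which is in [W], is at most [d] times the sum of
      the [F]-degrees and of the numbers of frozen tokens on [W], plus an error
      [O(#|W|)].  But this sum is [2 * #|W| - m], so [m * d = O(#|W|)] ([no_violation]).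

    Tour.  Some closed walk of length [O(n / d)] comes within distance two of
    every vertex ([backbone]): extend it greedily by vertices at distance
    exactly three from the set of the earlier ones; their closed neighbourhoods
    are disjoint.  Detours make it visit all ends of the paths of the forest.  Pairing these
    ends in their order along the walk gives arcs of total length at most that
    of the walk ([arcs_along]); the paths and arcs together form closed walks
    ([close_up]), which are inserted into the walk.  The tour has length at most
    [(1 + 76 / d) * n]. *)

(** * Edge sets of bounded degree and acyclicity *)

Section EdgeSets.
Variable V : finType.
Implicit Types (F H : {set V * V}) (u v x y z : V).

(** A subgraph is a set [F] of ordered pairs, meant to be symmetric, so that
    [#|F|] is twice its number of edges. *)
Definition adj F : rel V := fun x y => (x, y) \in F.
Definition degree F x := #|[set y | adj F x y]|.
Definition del_edge F x y := F :\ (x, y) :\ (y, x).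
Definition add_edge F x y := (x, y) |: ((y, x) |: F).

Lemma adj_del_edge F x y a b :
  adj (del_edge F x y) a b =
  [&& (a, b) != (x, y), (a, b) != (y, x) & adj F a b].
Proof. by rewrite /adj !inE andbCA. Qed.

Lemma adj_add_edge F x y a b :
  adj (add_edge F x y) a b = [|| (a, b) == (x, y), (a, b) == (y, x) | adj F a b].
Proof. by rewrite /adj !inE. Qed.

Lemma adj_del_edgeW F x y a b : adj (del_edge F x y) a b -> adj F a b.
Proof. by rewrite adj_del_edge => /and3P[]. Qed.

Lemma sym_del_edge F x y :
  symmetric (adj F) -> symmetric (adj (del_edge F x y)).
Proof.
move=> sF a b; rewrite !adj_del_edge sF !xpair_eqE.
by rewrite [(b == x) && _]andbC [(b == y) && _]andbC andbCA.
Qed.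

Lemma sym_add_edge F x y :
  symmetric (adj F) -> symmetric (adj (add_edge F x y)).
Proof.
move=> sF a b; rewrite !adj_add_edge sF !xpair_eqE.
by rewrite [(b == x) && _]andbC [(b == y) && _]andbC orbCA.
Qed.

Lemma sum_degree F : \sum_x degree F x = #|F|.
Proof.
rewrite -sum1_card (eq_bigl (fun p : V * V => true && adj F p.1 p.2));
  last first.
  by case.
rewrite -(pair_big_dep xpredT (fun i j => adj F i j) (fun _ _ => 1)) /=.
by apply: eq_bigr => x _; rewrite sum1dep_card /degree.
Qed.

Lemma leq_uniq_degree F x (s : seq V) :
  uniq s -> all (adj F x) s -> size s <= degree F x.
Proof.
move=> us /allP as_; rewrite -(card_uniqP us); apply: subset_leq_card.
by apply/subsetP => y /as_; rewrite inE.
Qed.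

(** In a graph of maximum degree two, paths without repetition that start with
    the same edge [w x] and stop at a vertex of degree one stop at the same
    vertex: they have no choice on the way. *)
Lemma last_end_unique F w x p q :
  (forall z, degree F z <= 2) -> symmetric (adj F) -> adj F w x ->
  path (adj F) x p -> path (adj F) x q ->
  uniq [:: w, x & p] -> uniq [:: w, x & q] ->
  degree F (last x p) <= 1 -> degree F (last x q) <= 1 -> last x p = last x q.
Proof.
move=> d2 sF; elim: p w x q => [|y p IH] w x [|z q] //= wx.
- move=> _ /andP[xz _]; rewrite !inE => _ /and3P[/norP[_ /norP[wz _]] _ _] dx _.
  have := @leq_uniq_degree F x [:: w; z];
    rewrite /= inE wz sF wx xz => /(_ isT isT).
  by move/leq_trans/(_ dx).
- case/andP=> xz _ _; rewrite !inE => /and3P[/norP[_ /norP[wz _]] _ _] _ _ dx.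
  have := @leq_uniq_degree F x [:: w; y];
    rewrite /= inE wz sF wx xz => /(_ isT isT).
  by move/leq_trans/(_ dx).
case/andP=> xy yp /andP[xz zq]; rewrite !inE.
case/and3P=> /norP[_ /norP[wy _]] /norP[xNy xp] uy.
case/and3P=> /norP[_ /norP[wz _]] /norP[xNz xq] uz.
have [yz|yNz] := eqVneq y z; last first.
  have := @leq_uniq_degree F x [:: w; y; z].
  rewrite /= !inE negb_or wy wz yNz sF wx xy xz => /(_ isT isT).
  by move/leq_trans/(_ (d2 x)).
rewrite -{}yz in zq uz xNz *.
by apply: (IH x) => //=; rewrite inE negb_or xNy ?xp ?xq.
Qed.

(** A component of a graph of maximum degree two has at most two vertices of
    degree at most one. *)
Lemma three_ends F a b c :
  (forall z, degree F z <= 2) -> symmetric (adj F) ->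
  degree F a <= 1 -> degree F b <= 1 -> degree F c <= 1 -> a != b -> a != c ->
  connect (adj F) a b -> connect (adj F) a c -> b = c.
Proof.
move=> d2 sF da db dc ab ac /connectP[p0 p0a Eb] /connectP[q0 q0a Ec].
move: ab ac db dc; rewrite {}Eb {}Ec.
case/shortenP: p0a => p pa up _; case/shortenP: q0a => q qa uq _.
case: p q pa qa up uq => [|y p] [|z q] //=; rewrite ?eqxx //.
case/andP=> ay yp /andP[az zq] up uq _ _ db dc.
have [yz|yNz] := eqVneq y z; last first.
  have := @leq_uniq_degree F a [:: y; z];
    rewrite /= inE yNz ay az => /(_ isT isT).
  by move/leq_trans/(_ da).
rewrite -yz in zq uq dc *.
exact: (@last_end_unique F a y p q).
Qed.

Lemma connect_add_edge F u x a b :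
  connect (adj (add_edge F u x)) a b ->
  [|| connect (adj F) a b, connect (adj F) a u && connect (adj F) x b |
      connect (adj F) a x && connect (adj F) u b].
Proof.
case/connectP=> p; elim/last_ind: p b => [|p c IH] b /=.
  by move=> _ ->; rewrite connect0.
rewrite rcons_path last_rcons => /andP[ap xc] ->.
move: (IH _ ap erefl) xc; rewrite adj_add_edge; set w := last a p => {IH}.
move=> IH /or3P[/eqP[wu cx]|/eqP[wx cu]|wc].
- rewrite wu cx in IH *.
  by case/or3P: IH => [->|/andP[-> _]|/andP[-> _]]; rewrite ?connect0 ?orbT.
- rewrite wx cu in IH *.
  by case/or3P: IH => [->|/andP[-> _]|/andP[-> _]]; rewrite ?connect0 ?orbT.
have tr z : connect (adj F) z w -> connect (adj F) z c.
  by move/connect_trans; apply; apply: connect1.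
by case/or3P: IH => [/tr->|/andP[-> /tr->]|/andP[-> /tr->]]; rewrite ?orbT.
Qed.

(** A graph is acyclic when each of its edges is a bridge. *)
Definition acyclic F :=
  [forall x, forall y, adj F x y ==> ~~ connect (adj (del_edge F x y)) x y].

Lemma acyclicP F :
  reflect (forall x y, adj F x y -> ~~ connect (adj (del_edge F x y)) x y) (acyclic F).
Proof.
apply: (iffP forallP) => [H x y|H x]; first by apply/implyP/(forallP (H x)).
by apply/forallP => y; apply/implyP/H.
Qed.

Lemma connect_subadj F H a b :
  {subset F <= H} -> connect (adj F) a b -> connect (adj H) a b.
Proof. by move=> FH; apply: connect_sub => x y xy; apply/connect1/FH. Qed.

Lemma acyclic_del_edge F x y : acyclic F -> acyclic (del_edge F x y).
Proof.
move=> /acyclicP aF; apply/acyclicP => a b /adj_del_edgeW ab.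
apply: contra (aF _ _ ab); apply: connect_subadj => p.
by rewrite !inE => /and5P[-> -> _ _ ->].
Qed.

Lemma acyclic_add_edge F u x :
  symmetric (adj F) -> acyclic F -> ~~ connect (adj F) u x -> acyclic (add_edge F u x).
Proof.
move=> sF /acyclicP aF ux; have cs := sym_connect_sym sF; apply/acyclicP => a b.
have [E|N1] := eqVneq (a, b) (u, x).
  move=> _; case: E => -> ->; apply: contra ux; apply: connect_subadj => p.
  by rewrite !inE => /and3P[/negPf-> /negPf->].
have [E|N2] := eqVneq (a, b) (x, u).
  move=> _; case: E => -> ->; apply: contra ux; rewrite (cs u x);
    apply: connect_subadj => p.
  by rewrite !inE => /and3P[/negPf-> /negPf->].
rewrite adj_add_edge (negPf N1) (negPf N2) /= => ab; apply/negP => cab.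
have := aF _ _ ab; have Fab := connect1 ab.
have {cab}: connect (adj (add_edge (del_edge F a b) u x)) a b.
  apply: connect_subadj cab => p; rewrite !inE.
  by case: eqP; case: eqP => //=.
have sub: forall z w, connect (adj (del_edge F a b)) z w -> connect (adj F) z w.
  by move=> z w; apply: connect_subadj => p; rewrite !inE => /and3P[].
case/connect_add_edge/or3P => [->//|/andP[/sub au /sub xb]|/andP[/sub ax /sub ub]] _.
  case/negP: ux; rewrite cs in au; apply: connect_trans au _.
  by apply: connect_trans Fab _; rewrite cs.
case/negP: ux; apply: connect_trans ub _; rewrite cs in Fab.
by apply: connect_trans Fab _.
Qed.

Lemma acyclic_side F u x y1 y2 :
  symmetric (adj F) -> degree F x <= 2 -> adj F x y1 -> adj F x y2 -> y1 != y2 ->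
  u != x -> connect (adj (del_edge F x y1)) u x ->
  connect (adj (del_edge (del_edge F x y1) x y2)) u y2.
Proof.
move=> sF d2 xy1 xy2 y12 ux; set H := del_edge (del_edge F x y1) x y2.
have sH : symmetric (adj H) by do 2!apply: sym_del_edge.
have iso : ~~ connect (adj H) u x.
  rewrite (sym_connect_sym sH); apply/negP => /connectP[[|z p] /=].
    by move=> _ E; rewrite E eqxx in ux.
  case/andP;
    rewrite !adj_del_edge !xpair_eqE !eqxx /= => /and5P[zy2 _ zy1 _ xz] _ _.
  have := @leq_uniq_degree F x [:: z; y1; y2].
  rewrite /= !inE negb_or zy1 zy2 y12 xz xy1 xy2 => /(_ isT isT).
  by move/leq_trans/(_ d2).
move=> cux; have {cux}: connect (adj (add_edge H x y2)) u x.
  apply: connect_subadj cux => p; rewrite /H !inE.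
  by case: (p == (x, y2)) => //; case: (p == (y2, x)) => //=.
by case/connect_add_edge/or3P => [H1|/andP[H1 _]|/andP[H1 _]] //;
  rewrite H1 in iso.
Qed.

(** If [u] is joined to [x] after the deletion of either edge at [x], then [x]
    lies on a cycle. *)
Lemma acyclic_two_sides F u x y1 y2 :
  symmetric (adj F) -> acyclic F -> degree F x <= 2 ->
  adj F x y1 -> adj F x y2 -> y1 != y2 -> u != x ->
  connect (adj (del_edge F x y1)) u x -> connect (adj (del_edge F x y2)) u x -> False.
Proof.
move=> sF /acyclicP aF d2 xy1 xy2 y12 ux c1 c2.
have y21 : y2 != y1 by rewrite eq_sym.
have h1 := acyclic_side sF d2 xy2 xy1 y21 ux c2.
case/negP: (aF _ _ xy1).
have s1 := sym_connect_sym (sym_del_edge x y1 sF).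
rewrite s1; apply: connect_trans (_ : connect _ y1 u) _.
  rewrite s1; apply: connect_subadj h1 => p.
  by rewrite !inE => /and5P[-> -> _ _ ->].
exact: c1.
Qed.

End EdgeSets.

(** * Linear forests and token rotations *)

Section Rotations.
Variable V : finType.
Implicit Types (F H : {set V * V}) (u v x y z : V).

Lemma degree_add_edge F u x z : symmetric (adj F) -> u != x -> ~~ adj F u x ->
  degree (add_edge F u x) z = degree F z + (z == u) + (z == x).
Proof.
move=> sF ux nux; rewrite /degree.
have [->|zu] := eqVneq z u.
  rewrite (negPf ux) addn0 addn1.
  rewrite (_ : [set y | _] = x |: [set y | adj F u y]).
    by rewrite cardsU1 inE nux.
  by apply/setP=> y; rewrite !inE adj_add_edge !xpair_eqE eqxx (negPf ux).
have [->|zx] := eqVneq z x.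
  rewrite addn0 addn1 (_ : [set y | _] = u |: [set y | adj F x y]).
    by rewrite cardsU1 inE sF nux.
  apply/setP=> y; rewrite !inE adj_add_edge !xpair_eqE eqxx [x == u]eq_sym.
  by rewrite (negPf ux).
rewrite !addn0; congr #|pred_of_set _|; apply/setP=> y.
by rewrite !inE adj_add_edge !xpair_eqE (negPf zu) (negPf zx).
Qed.

Lemma del_edgeK F x y :
  symmetric (adj F) -> adj F x y -> add_edge (del_edge F x y) x y = F.
Proof.
move=> sF xy; apply/setP => p; rewrite !inE.
have [->|_] := eqVneq p (x, y); first by rewrite -[RHS]/(adj F x y) xy.
have [->|_] //= := eqVneq p (y, x).
by rewrite -[RHS]/(adj F y x) sF xy.
Qed.

Lemma degree_del_edge F x y z : symmetric (adj F) -> x != y -> adj F x y ->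
  degree (del_edge F x y) z + (z == x) + (z == y) = degree F z.
Proof.
move=> sF nxy xy; rewrite -{2}(del_edgeK sF xy) degree_add_edge //;
  first exact: sym_del_edge.
by rewrite adj_del_edge eqxx.
Qed.

Lemma sum_pred1 (z : V) : \sum_x (x == z : nat) = 1.
Proof. by rewrite (bigD1 z) //= eqxx big1 // => i /negPf->. Qed.

Lemma card_add_edge F u x : symmetric (adj F) -> u != x -> ~~ adj F u x ->
  #|add_edge F u x| = #|F| + 2.
Proof.
move=> sF ux nux; rewrite -!sum_degree.
under eq_bigr => z _ do rewrite degree_add_edge //.
by rewrite !big_split /= !sum_pred1; lia.
Qed.

Lemma card_del_edge F x y : symmetric (adj F) -> x != y -> adj F x y ->
  #|del_edge F x y| + 2 = #|F|.
Proof.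
move=> sF nxy xy; rewrite -{2}(del_edgeK sF xy) card_add_edge //;
  first exact: sym_del_edge.
by rewrite adj_del_edge eqxx.
Qed.

Lemma degree_del_edge_le F x y z : degree (del_edge F x y) z <= degree F z.
Proof.
by apply: subset_leq_card; apply/subsetP=> t; rewrite !inE => /adj_del_edgeW.
Qed.

Variable e : rel V.
Hypotheses (sym_e : symmetric e) (irr_e : irreflexive e).

(** The linear forests contained in the graph [e]; all vertices
    belong to them, those without edges being components of their own. *)
Definition linear_forest F :=
  [&& [forall x, forall y, adj F x y ==> e x y && adj F y x],
      [forall x, degree F x <= 2] & acyclic F].

Lemma linear_forestP F :
  reflect [/\ symmetric (adj F), forall x y, adj F x y -> e x y,
              forall x, degree F x <= 2 & acyclic F] (linear_forest F).
Proof.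
apply: (iffP and3P) => [[/forallP H1 /forallP H2 aF]|[sF Fe H2 aF]]; split=> //.
- have h x y : adj F x y -> adj F y x.
    by move=> xy; have /forallP/(_ y)/implyP/(_ xy)/andP[] := H1 x.
  by move=> x y; apply/idP/idP => /h.
- by move=> x y xy; have /forallP/(_ y)/implyP/(_ xy)/andP[] := H1 x.
- by apply/forallP=> x; apply/forallP=> y; apply/implyP=> xy; rewrite Fe // -sF.
by apply/forallP.
Qed.

Lemma linear_forest_add_edge F u x :
  linear_forest F -> e u x -> degree F u < 2 -> degree F x < 2 ->
  ~~ connect (adj F) u x -> linear_forest (add_edge F u x).
Proof.
move=> /linear_forestP[sF Fe d2 aF] ux du dx nc.
have nux : u != x by apply: contraNneq nc => ->; rewrite connect0.
have nF : ~~ adj F u x by apply: contra nc => /connect1.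
apply/linear_forestP; split; first exact: sym_add_edge.
- by move=> a b; rewrite adj_add_edge => /or3P[/eqP[-> ->]|/eqP[-> ->]|/Fe] //;
    rewrite sym_e.
- move=> z; rewrite degree_add_edge //; have := d2 z.
  have [->|_] := eqVneq z u; first by rewrite (negPf nux); lia.
  by have [->|_] := eqVneq z x; lia.
exact: acyclic_add_edge.
Qed.

Lemma linear_forest_del_edge F x y :
  linear_forest F -> linear_forest (del_edge F x y).
Proof.
move=> /linear_forestP[sF Fe d2 aF]; apply/linear_forestP; split.
- exact: sym_del_edge.
- by move=> a b /adj_del_edgeW/Fe.
- by move=> z; apply: leq_trans (d2 z); apply: degree_del_edge_le.
exact: acyclic_del_edge.
Qed.

Definition max_linear_forest F :=
  linear_forest F /\ forall H, linear_forest H -> #|H| <= #|F|.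

Lemma ends_connected F u x : max_linear_forest F -> e u x ->
  degree F u < 2 -> degree F x < 2 -> connect (adj F) u x.
Proof.
move=> [lF maxF] ux du dx; apply/negPn/negP => nc.
have [sF _ _ _] := linear_forestP _ lF.
have := maxF _ (linear_forest_add_edge lF ux du dx nc).
rewrite card_add_edge //; first by lia.
  by apply: contraNneq nc => ->; rewrite connect0.
by apply: contra nc => /connect1.
Qed.

Implicit Types c : V -> nat.

(** The number of mobile tokens at [v], where [c v] tokens are frozen. *)
Definition tokens c F v := 2 - c v - degree F v.

(** Moves a token from [u] to [y] through the pivot [x]. *)
Definition rotate F u x y := add_edge (del_edge F x y) u x.

(** Only the rotations that keep [F] acyclic are allowed. *)
Definition rotation_step c F F' := [exists u, exists x, exists y,
  [&& 0 < tokens c F u, e u x, ~~ adj F u x, adj F x y,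
      linear_forest (rotate F u x y) & F' == rotate F u x y]].

(** The vertices that carry a mobile token after some sequence of rotations. *)
Definition sites c F :=
  [set v | [exists F', connect (rotation_step c) F F' && (0 < tokens c F' v)]].

(** The second condition makes the truncated subtractions in [tokens] exact. *)
Definition admissible c F := max_linear_forest F /\ forall v, degree F v + c v <= 2.

Lemma rotation_stepP c F F' :
  reflect (exists u x y,
      [/\ 0 < tokens c F u, e u x, ~~ adj F u x, adj F x y &
          linear_forest (rotate F u x y) /\ F' = rotate F u x y])
    (rotation_step c F F').
Proof.
apply: (iffP existsP) => [[u /existsP[x /existsP[y /and5P[t ux n xy /andP[l /eqP ->]]]]]|].
  by exists u, x, y.
case=> u [x [y [t ux n xy [l ->]]]]; exists u; apply/existsP; exists x.
by apply/existsP; exists y; rewrite t ux n xy l eqxx.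
Qed.

Lemma card_rotate F u x y : symmetric (adj F) -> u != x -> x != y ->
  ~~ adj F u x -> adj F x y -> #|rotate F u x y| = #|F|.
Proof.
move=> sF ux nxy nux xy; rewrite /rotate card_add_edge ?card_del_edge //.
  exact: sym_del_edge.
by apply: contra nux => /adj_del_edgeW.
Qed.

Lemma degree_rotate F u x y z : symmetric (adj F) -> u != x -> x != y ->
  ~~ adj F u x -> adj F x y ->
  degree (rotate F u x y) z + (z == y) = degree F z + (z == u).
Proof.
move=> sF ux nxy nux xy; rewrite /rotate degree_add_edge.
- by rewrite -(degree_del_edge z sF nxy xy); lia.
- exact: sym_del_edge.
- by [].
by apply: contra nux => /adj_del_edgeW.
Qed.

Lemma adj_irr F x y : linear_forest F -> adj F x y -> x != y.
Proof. by case/linear_forestP => _ Fe _ _ /Fe; apply: contraTneq => ->;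
  rewrite irr_e. Qed.

Lemma e_irr x y : e x y -> x != y.
Proof. by apply: contraTneq => ->; rewrite irr_e. Qed.

Lemma admissible_step c F F' :
  admissible c F -> rotation_step c F F' -> admissible c F'.
Proof.
move=> [[lF maxF] cF] /rotation_stepP[u [x [y [t ux nux xy [lF' ->]]]]].
have [sF _ _ _] := linear_forestP _ lF.
have nxy := adj_irr lF xy; have nEux := e_irr ux.
split.
  by split=> // H /maxF; rewrite card_rotate.
move=> v; have := degree_rotate v sF nEux nxy nux xy; have := cF v.
move: t; rewrite /tokens; have [->|_] := eqVneq v u; lia.
Qed.

Lemma connect_rotation_ind c F (P : {set V * V} -> Prop) :
  P F -> (forall H H', connect (rotation_step c) F H -> rotation_step c H H' -> P H -> P H') ->
  forall H, connect (rotation_step c) F H -> P H.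
Proof.
move=> P0 PS H /connectP[p]; elim/last_ind: p H => [|p G IH] H /=;
  first by move=> _ ->.
rewrite rcons_path last_rcons => /andP[pp st] ->.
by apply: PS st (IH _ pp erefl); apply/connectP; exists p.
Qed.

Lemma admissible_reach c F H :
  admissible c F -> connect (rotation_step c) F H -> admissible c H.
Proof.
move=> st; apply: connect_rotation_ind => // G G' _ h s;
  exact: admissible_step s h.
Qed.

Definition total_tokens c F := \sum_v tokens c F v.

Lemma total_tokens_eq c F :
  admissible c F -> total_tokens c F + #|F| + \sum_v c v = 2 * #|V|.
Proof.
move=> [_ cF]; rewrite -sum_degree /total_tokens -!big_split /=.
rewrite (eq_bigr (fun=> 2)); first by rewrite sum_nat_const mulnC.
by move=> v _; rewrite /tokens; have := cF v; lia.
Qed.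

Lemma card_max F H : max_linear_forest F -> max_linear_forest H -> #|F| = #|H|.
Proof. by move=> [l1 m1] [l2 m2]; apply/eqP; rewrite eqn_leq m1 // m2. Qed.

Lemma total_tokens_reach c F H :
  admissible c F -> connect (rotation_step c) F H -> total_tokens c H = total_tokens c F.
Proof.
move=> st cH; have stH := admissible_reach st cH.
have := total_tokens_eq st; have := total_tokens_eq stH.
by rewrite (card_max stH.1 st.1); lia.
Qed.

Lemma sites_reach c F H :
  connect (rotation_step c) F H -> sites c H \subset sites c F.
Proof.
move=> FH; apply/subsetP => v; rewrite !inE => /existsP[G /andP[HG t]].
by apply/existsP; exists G; rewrite t (connect_trans FH HG).
Qed.

Lemma token_site c F H v :
  connect (rotation_step c) F H -> 0 < tokens c H v -> v \in sites c F.
Proof. by move=> FH t; rewrite inE; apply/existsP; exists H; rewrite FH. Qed.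

(** A token at [v], adjacent to [x], can move to the [F]-neighbour [y] of [x]
    unless deleting [x y] and adding [v x] closes a cycle.  The case where [v x]
    is already an edge of [F] falls under the second alternative. *)
Lemma rotate_or_joined c F v x y :
  admissible c F -> 0 < tokens c F v -> e v x ->
  adj F x y -> v != y -> (y \in sites c F) \/ connect (adj (del_edge F x y)) v x.
Proof.
move=> st t vx xy vy; have [[lF _] cF] := st.
have [sF _ d2 _] := linear_forestP _ lF.
have [cvx|ncvx] := boolP (connect (adj (del_edge F x y)) v x); [by right|left].
have nxy := adj_irr lF xy; have nvx := e_irr vx.
have nF : ~~ adj F v x.
  apply: contra ncvx => Fvx; apply: connect1;
    rewrite adj_del_edge Fvx !xpair_eqE.
  by rewrite (negPf nvx) (negPf vy).
have sD := sym_del_edge x y sF.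
have dD z := degree_del_edge z sF nxy xy.
have lF' : linear_forest (rotate F v x y).
  apply: linear_forest_add_edge => //; first exact: linear_forest_del_edge.
    apply: leq_ltn_trans (degree_del_edge_le _ _ _ _) _.
    by move: t; rewrite /tokens; lia.
  by have := dD x; have := d2 x; rewrite eqxx; lia.
have sFF' : rotation_step c F (rotate F v x y) by apply/rotation_stepP;
  exists v, x, y.
apply: token_site (connect1 sFF') _.
have := degree_rotate y sF nvx nxy nF xy;
  rewrite eqxx eq_sym (negPf vy) /tokens.
by have := cF y; lia.
Qed.

Lemma degree_of_token c F v : 0 < tokens c F v -> degree F v < 2.
Proof. by rewrite /tokens; lia. Qed.

(** Of the two edges of [F] at [x], one can be deleted without closing a
    cycle. *)
Lemma token_nbr_internal c F v x :
  admissible c F -> 0 < tokens c F v -> e v x ->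
  degree F x = 2 -> exists2 y, adj F x y & y \in sites c F.
Proof.
move=> st t vx dx; have [[lF _] cF] := st.
have [sF _ d2 aF] := linear_forestP _ lF.
have [y1 [y2 [y12 xy1 xy2]]] : exists y1 y2, [/\ y1 != y2, adj F x y1 & adj F x y2].
  move/eqP/cards2P: dx => [y1 [y2 [ny E]]]; exists y1, y2.
  by split=> //; have := set21 y1 y2; have := set22 y1 y2; rewrite -E !inE.
have vS : v \in sites c F by apply: token_site (connect0 _ _) t.
have [Ey1|ny1] := eqVneq v y1; first by exists y1 => //; rewrite -Ey1.
have [Ey2|ny2] := eqVneq v y2; first by exists y2 => //; rewrite -Ey2.
have [h|h1] := rotate_or_joined st t vx xy1 ny1; first by exists y1.
have [h|h2] := rotate_or_joined st t vx xy2 ny2; first by exists y2.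
case: (acyclic_two_sides sF aF (d2 x) xy1 xy2 y12 (e_irr vx) h1 h2).
Qed.

Definition nbhd x := [set y | e x y].

Lemma two_tokens c F (A : {set V}) : 2 <= \sum_(v in A) tokens c F v ->
  (exists v, [/\ v \in A, 0 < tokens c F v & degree F v = 0]) \/
  exists v1 v2, [/\ v1 \in A, v2 \in A, v1 != v2, 0 < tokens c F v1 & 0 < tokens c F v2].
Proof.
move=> h2.
have [v1 A1 t1] : exists2 v, v \in A & 0 < tokens c F v.
  apply/exists_inP; apply: contraLR h2; rewrite negb_exists_in => /forall_inP h.
  by rewrite -ltnNge big1 // => v /h; lia.
have [E|N] := leqP 2 (tokens c F v1).
  by left; exists v1; split=> //; move: E; rewrite /tokens; lia.
right;
  have [v2 /andP[A2 n2] t2] : exists2 v, (v \in A) && (v != v1) & 0 < tokens c F v.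
  apply/exists_inP; apply: contraLR h2; rewrite negb_exists_in => /forall_inP h.
  by rewrite -ltnNge (bigD1 v1) //= big1 ?addn0 // => v /h; lia.
by exists v1, v2; rewrite eq_sym.
Qed.

Lemma isolated_connect F v x :
  degree F v = 0 -> v != x -> ~~ connect (adj F) v x.
Proof.
move/eqP; rewrite cards_eq0 => /eqP E nvx; apply/negP => /connectP[[|y p] /=].
  by move=> _ E'; rewrite E' eqxx in nvx.
by case/andP => vy; have := in_set0 y; rewrite -E inE vy.
Qed.

(** Two tokens adjacent to an end [x] of a path of [F] would lie, by maximality
    of [F], in the component of [x], which would then have three ends.  A vertex
    with two tokens is isolated in [F] and could be joined to [x]. *)
Lemma tokens_near_end c F x : admissible c F -> degree F x < 2 ->
  \sum_(v in nbhd x) tokens c F v < 2.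
Proof.
move=> [mF cF] dx; have [sF _ d2 _] := linear_forestP _ mF.1.
rewrite ltnNge; apply/negP => /two_tokens[[v]|[v1 [v2]]].
  rewrite inE sym_e => -[vx _ v0]; have := isolated_connect v0 (e_irr vx).
  by rewrite ends_connected // v0.
rewrite !inE => -[xv1 xv2 v12 /degree_of_token t1 /degree_of_token t2].
have c1 := ends_connected mF xv1 dx t1.
have c2 := ends_connected mF xv2 dx t2.
by have := three_ends d2 sF dx t1 t2 (e_irr xv1) (e_irr xv2) c1 c2; apply/eqP.
Qed.

(** If neither token could move to [y], then both would be joined to [x] after
    the deletion of [x y], and the component of [x] would have three ends. *)
Lemma tokens_near_internal c F x y : admissible c F -> adj F x y ->
  2 <= \sum_(v in nbhd x) tokens c F v -> y \in sites c F.
Proof.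
move=> st xy h; have [mF cF] := st; have lF := mF.1.
have [sF Fe d2 aF] := linear_forestP _ lF.
have S0 v : 0 < tokens c F v -> v \in sites c F by apply: token_site;
  apply: connect0.
have nxy := adj_irr lF xy.
have dx : degree (del_edge F x y) x <= 1.
  by have := degree_del_edge x sF nxy xy; have := d2 x; rewrite eqxx; lia.
case/two_tokens: h => [[v]|[v1 [v2]]].
  rewrite [_ \in nbhd _]inE sym_e => -[vx t v0].
  have vy : v != y.
    apply: contraTneq xy => E; have := isolated_connect v0 (e_irr vx).
    by rewrite E; apply: contra => xy; rewrite connect1 // sF.
  have [//|cvx] := rotate_or_joined st t vx xy vy.
  have v0' : degree (del_edge F x y) v = 0.
    by apply/eqP; rewrite -leqn0 -v0 degree_del_edge_le.
  by rewrite (negPf (isolated_connect v0' (e_irr vx))) in cvx.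
rewrite ![_ \in nbhd _]inE ![e x _]sym_e => -[xv1 xv2 v12 t1 t2].
have [E|ny1] := eqVneq v1 y; first by rewrite -E; apply: S0.
have [E|ny2] := eqVneq v2 y; first by rewrite -E; apply: S0.
have [//|c1] := rotate_or_joined st t1 xv1 xy ny1.
have [//|c2] := rotate_or_joined st t2 xv2 xy ny2.
have sD := sym_del_edge x y sF.
have dl v : 0 < tokens c F v -> degree (del_edge F x y) v <= 1.
  by move/degree_of_token; apply: leq_ltn_trans; apply: degree_del_edge_le.
rewrite (sym_connect_sym sD) in c1; rewrite (sym_connect_sym sD) in c2.
have n1 := e_irr xv1; have n2 := e_irr xv2; rewrite eq_sym in n1;
  rewrite eq_sym in n2.
have dd z : degree (del_edge F x y) z <= 2 by apply: leq_trans (d2 z);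
  apply: degree_del_edge_le.
have E := three_ends dd sD dx (dl _ t1) (dl _ t2) n1 n2 c1 c2.
by rewrite E eqxx in v12.
Qed.

Lemma connect_rotation_mono c c' F H : (forall v, c v <= c' v) ->
  connect (rotation_step c') F H -> connect (rotation_step c) F H.
Proof.
move=> cc';
  apply: connect_sub => G1 G2 /rotation_stepP[u [x [y [t ux nux xy h]]]].
apply: connect1; apply/rotation_stepP; exists u, x, y; split=> //.
by move: t (cc' u); rewrite /tokens; lia.
Qed.

(** If the claim holds for all token systems with fewer than [N] sites, then the
    tokens can be moved until few of them lie in [R]. *)
Lemma concentrate c F (R : {set V}) d N : admissible c F -> #|R| < N ->
  (forall c' F', admissible c' F' -> #|sites c' F'| < N ->
      total_tokens c' F' * d <= 8 * #|sites c' F'|) ->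
  exists2 H, connect (rotation_step c) F H & (\sum_(v in R) tokens c H v) * d <= 8 * #|R|.
Proof.
move=> st RN IH.
pose P H := connect (rotation_step c) F H;
  pose m H := \sum_(v in R) tokens c H v.
have PF : P F by apply: connect0.
case: (@arg_minnP _ F P m PF) => H FH minH; exists H => //.
have stH := admissible_reach st FH.
(* With the tokens outside [R] frozen, a token leaving [R] would contradict the
   choice of [H]; hence all sites are in [R]. *)
pose c' v := if v \in R then c v else 2 - degree H v.
have cc' v : c v <= c' v by rewrite /c'; case: ifP => // _; have := stH.2 v;
  lia.
have stH' : admissible c' H.
  split; first exact: stH.1.
  by move=> v; rewrite /c'; have := stH.2 v; case: ifP => _; lia.
have sub G : connect (rotation_step c') H G -> connect (rotation_step c) H G.
  exact: connect_rotation_mono.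
have totH : total_tokens c' H = m H.
  rewrite /total_tokens /m [RHS]big_mkcond; apply: eq_bigr => v _;
    rewrite /tokens /c'.
  by case: ifP => // _; lia.
have subR : sites c' H \subset R.
  apply/subsetP => v; rewrite inE => /existsP[G /andP[HG t]].
  apply: contraTT t => vR; rewrite -eqn0Ngt.
  have := minH _ (connect_trans FH (sub _ HG));
    rewrite -totH -(total_tokens_reach stH' HG).
  have -> : m G = \sum_(w in R) tokens c' G w.
    by apply: eq_bigr => w wR; rewrite /tokens /c' wR.
  rewrite /total_tokens (bigID (mem R)) /= -[leqRHS]addn0 leq_add2l leqn0 sum_nat_eq0.
  by move/forallP/(_ v)/implyP/(_ vR).
have := IH _ _ stH' (leq_ltn_trans (subset_leq_card subR) RN).
rewrite totH => /leq_trans; apply; rewrite leq_mul2l /=.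
exact: subset_leq_card.
Qed.

End Rotations.

(** * The bound on the number of tokens *)

Section Counting.
Variables (V : finType) (e : rel V) (d : nat).
Hypotheses (sym_e : symmetric e) (irr_e : irreflexive e).
Hypothesis reg_e : forall x, #|[set y | e x y]| = d.
Implicit Types (F H : {set V * V}) (A B : {set V}) (u v x y z : V) (c : V -> nat).
Local Notation sites := (sites e).
Local Notation rotation_step := (rotation_step e).
Local Notation admissible := (admissible e).

Definition degree_in (r : rel V) A x := #|[set y in A | r x y]|.

Lemma degree_inE (r : rel V) A x :
  degree_in r A x = \sum_(y in A) (r x y : nat).
Proof.
rewrite /degree_in -sum1_card -big_mkcondr; apply: eq_bigl => y.
by rewrite !inE.
Qed.

(** Double counting of the edges between [A] and [B]. *)
Lemma degree_in_swap (r : rel V) A B : symmetric r ->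
  \sum_(x in A) degree_in r B x = \sum_(y in B) degree_in r A y.
Proof.
move=> sr; under eq_bigr do rewrite degree_inE.
rewrite exchange_big; apply: eq_bigr => y _; rewrite degree_inE.
by apply: eq_bigr => x _; rewrite sr.
Qed.

Lemma degree_in_le (r : rel V) A B x :
  A \subset B -> degree_in r A x <= degree_in r B x.
Proof.
move=> /subsetP AB; apply: subset_leq_card; apply/subsetP => y.
by rewrite !inE => /andP[/AB-> ->].
Qed.

Lemma degree_in_regular A x : degree_in e A x <= d.
Proof.
rewrite -(reg_e x); apply: subset_leq_card; apply/subsetP => y.
by rewrite !inE => /andP[].
Qed.

Lemma rotation_step_adj c F F' :
  rotation_step c F F' -> admissible c F -> exists u x y,
  [/\ 0 < tokens c F u, ~~ adj F u x, adj F x y & 0 < tokens c F' y] /\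
  forall a b, adj F' a b =
   [|| (a, b) == (u, x), (a, b) == (x, u) |
      [&& (a, b) != (x, y), (a, b) != (y, x) & adj F a b]].
Proof.
move=> s st; have st' := admissible_step irr_e st s.
have [[lF _] cF] := st; have [sF _ _ _] := linear_forestP _ _ lF.
move: s => /rotation_stepP[u [x [y [t ux nux xy [lF' E]]]]]; rewrite E in st' *.
have nux' := e_irr irr_e ux; have nxy := adj_irr irr_e lF xy.
exists u, x, y; split; last by move=> a b; rewrite adj_add_edge adj_del_edge.
split=> //; have := degree_rotate y sF nux' nxy nux xy; rewrite eqxx /tokens.
have -> : (y == u) = false by apply: contraNF nux => /eqP <-; rewrite sF.
by have := cF y; lia.
Qed.

(** Rotations with pivot [x] exchange a neighbour in [sites c F] for another
    one. *)
Lemma degree_sites_invariant c F H x :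
  admissible c F -> connect (rotation_step c) F H ->
  x \notin sites c F -> degree_in (adj H) (sites c F) x = degree_in (adj F) (sites c F) x.
Proof.
move=> st FH xS; move: H FH; apply: connect_rotation_ind => // H H' FH s <-.
have stH := admissible_reach irr_e st FH.
have [u [p [y [[tu nup py ty] E]]]] := rotation_step_adj s stH.
have uS := token_site FH tu.
have yS : y \in sites c F by apply: token_site ty;
  apply: connect_trans FH (connect1 s).
have xu : x != u by apply: contraNneq xS => ->.
have xy : x != y by apply: contraNneq xS => ->.
rewrite !degree_inE; have [xp|xp] := eqVneq x p; last first.
  apply: eq_bigr => z _; rewrite E !xpair_eqE.
  by rewrite (negPf xu) (negPf xp) (negPf xy).
have [[lH _] _] := stH; have [sH _ _ _] := linear_forestP _ _ lH.
have sum1 w : w \in sites c F -> \sum_(z in sites c F) (z == w : nat) = 1.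
  by move=> wS; rewrite (bigD1 w) //= eqxx big1 // => z /andP[_ /negPf->].
apply/eqP; rewrite -(eqn_add2r 1) -{1}(sum1 _ yS) -(sum1 _ uS) -!big_split /=.
apply/eqP/eq_bigr => z _; rewrite E xp !xpair_eqE eqxx /=.
move: xu xy; rewrite xp => /negPf-> /negPf-> /=.
have [->|zy] := eqVneq z y.
  rewrite py; have [Ey|//] := eqVneq y u.
  by move: nup; rewrite -Ey sH py.
have [->|//] := eqVneq z u.
by rewrite sH (negPf nup).
Qed.

(** A token system that violates the bound, with the least number of sites. *)
Section Violation.
Variables (c : V -> nat) (F : {set V * V}).
Hypothesis st : admissible c F.
Let W := sites c F.
Let m := total_tokens c F.
Hypothesis IH : forall c' F', admissible c' F' -> #|sites c' F'| < #|W| ->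
  total_tokens c' F' * d <= 8 * #|sites c' F'|.
Hypothesis big : 8 * #|W| < m * d.

Lemma total_tokens_sites c' H : admissible c' H -> sites c' H \subset W ->
  total_tokens c' H = \sum_(v in W) tokens c' H v.
Proof.
move=> st' /subsetP sub;
  rewrite /total_tokens (bigID (mem W)) /= [X in _ + X]big1 ?addn0 //.
move=> v; apply: contraNeq; rewrite -lt0n => t; apply: sub.
by apply: token_site t; apply: connect0.
Qed.

Lemma card_setD_nbhd x : #|W :\: nbhd e x| + degree_in e W x = #|W|.
Proof.
rewrite addnC /degree_in -(cardsID (nbhd e x) W); congr (_ + _).
by apply: eq_card => y; rewrite !inE.
Qed.

Lemma split_tokens_nbhd c' H x : admissible c' H -> sites c' H \subset W ->
  total_tokens c' H <=
  \sum_(v in nbhd e x) tokens c' H v + \sum_(v in W :\: nbhd e x) tokens c' H v.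
Proof.
move=> st' /(total_tokens_sites st')->; rewrite (bigID (mem (nbhd e x))) /=;
  apply: leq_add.
  rewrite [leqRHS](bigID (mem W)) /=; apply: leq_trans (leq_addr _ _).
  by rewrite leq_eqVlt; apply/orP; left; apply/eqP/eq_bigl => v; rewrite andbC.
rewrite leq_eqVlt; apply/orP; left; apply/eqP/eq_bigl => v.
by rewrite !inE andbC.
Qed.

(** Two tokens can be gathered in the neighbourhood of [x]; both neighbours of
    [x] then become sites. *)
Lemma degree_outside x :
  x \notin W -> d < 2 * degree_in e W x -> 2 <= degree_in (adj F) W x.
Proof.
move=> xW dx; have cW := card_setD_nbhd x.
have RW : #|W :\: nbhd e x| < #|W| by lia.
have [H FH hj] := concentrate irr_e st RW IH.
have stH := admissible_reach irr_e st FH.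
have subH : sites c H \subset W := sites_reach FH.
have := split_tokens_nbhd x stH subH;
  rewrite (total_tokens_reach irr_e st FH) -/m => hm.
have two : 2 <= \sum_(v in nbhd e x) tokens c H v by nia.
have dHx : 2 <= degree H x.
  by rewrite leqNgt; apply: contraL two => /(tokens_near_end sym_e irr_e stH);
    rewrite -ltnNge.
rewrite -(degree_sites_invariant st FH xW); apply: leq_trans dHx _.
apply: subset_leq_card; apply/subsetP => y; rewrite !inE => xy;
  rewrite xy andbT.
have := subsetP subH y (tokens_near_internal sym_e irr_e stH xy two).
by rewrite inE.
Qed.

(** After a token has been brought to [x] and frozen there, two more tokens
    could be gathered in the neighbourhood of the end [x]. *)
Lemma degree_inside x : x \in W -> 4 * degree_in e W x <= d.
Proof.
move=> xW; rewrite leqNgt; apply/negP => dx; have cW := card_setD_nbhd x.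
have RW : #|W :\: nbhd e x| < #|W| by lia.
have := xW; rewrite inE => /existsP[F1 /andP[FF1 t1]].
have st1 := admissible_reach irr_e st FF1.
pose c1 v := c v + (v == x).
have cc1 v : c v <= c1 v by rewrite /c1; lia.
have st1' : admissible c1 F1.
  split; first exact: st1.1.
  move=> v; rewrite /c1; have := st1.2 v; move: t1; rewrite /tokens.
  by have [->|_] := eqVneq v x; lia.
have tot1 : total_tokens c1 F1 + 1 = m.
  rewrite /m -(total_tokens_reach irr_e st FF1) /total_tokens -(sum_pred1 x) -big_split /=.
  apply: eq_bigr => v _; rewrite /tokens /c1; move: t1; rewrite /tokens.
  by have [->|_] := eqVneq v x; lia.
have [H F1H hj] := concentrate irr_e st1' RW IH.
have stH := admissible_reach irr_e st1' F1H.
have subH : sites c1 H \subset W.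
  apply/subsetP => v; rewrite inE => /existsP[G /andP[HG t]].
  have FG : connect (rotation_step c) F G.
    apply: connect_trans FF1 _; apply: (connect_rotation_mono cc1).
    exact: connect_trans HG.
  apply: (token_site FG); move: t; rewrite /tokens.
  by have := cc1 v; lia.
have := split_tokens_nbhd x stH subH;
  rewrite (total_tokens_reach irr_e st1' F1H) => hm.
have two : 2 <= \sum_(v in nbhd e x) tokens c1 H v by nia.
have dHx : degree H x < 2 by have := stH.2 x; rewrite /c1 eqxx; lia.
by have := tokens_near_end sym_e irr_e stH dHx; lia.
Qed.

(** The vertices outside [W] without [F]-neighbours in [W]. *)
Definition outer0 := [set x | (x \notin W) && (degree_in (adj F) W x == 0)].

Lemma degree_in0 (r : rel V) A x y :
  degree_in r A x = 0 -> y \in A -> r x y = false.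
Proof.
move/eqP; rewrite cards_eq0 => /eqP E yA; apply/negP => xy.
by have := in_set0 y; rewrite -E inE yA xy.
Qed.

(** When [v] carries a token, its neighbours in [outer0] are ends of paths,
    since otherwise a rotation would show that they have an [F]-neighbour in [W];
    by maximality they are the other end of the path of [v]. *)
Lemma outer0_nbhd v : v \in W -> degree_in e outer0 v <= 1.
Proof.
rewrite inE => /existsP[H /andP[FH t]].
have stH := admissible_reach irr_e st FH; have [mH _] := stH.
have [sH _ d2 _] := linear_forestP _ _ mH.1.
have end_ x : x \in outer0 -> e v x -> degree H x <= 1.
  rewrite inE => /andP[xW /eqP f0] vx; rewrite leqNgt; apply/negP => dx.
  have dx2 : degree H x = 2 by have := d2 x; lia.
  have [y xy yS] := token_nbr_internal sym_e irr_e stH t vx dx2.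
  rewrite -(degree_sites_invariant st FH xW) in f0.
  by rewrite (degree_in0 f0 (subsetP (sites_reach FH) _ yS)) in xy.
apply/card_le1_eqP => x1 x2; rewrite 2!inE => /andP[o1 v1] /andP[o2 v2].
have tv := degree_of_token t.
apply: esym;
  apply: (three_ends d2 sH tv (end_ _ o1 v1) (end_ _ o2 v2) (e_irr irr_e v1) (e_irr irr_e v2)).
  by apply: (ends_connected sym_e mH v1 tv); apply: end_.
by apply: (ends_connected sym_e mH v2 tv); apply: end_.
Qed.

(** The vertices of [W] without [F]-neighbours in [W] and without frozen
    tokens.  Vertices with frozen tokens are excluded as they already lower the
    degree sum on [W]. *)
Definition inner0 := [set x in W | (degree_in (adj F) W x == 0) && (c x == 0)].

(** Let [u] have degree two.  A token at [x] can be rotated with pivot [u],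
    which contradicts that the [F]-neighbours of [u] are outside [W].  If [x]
    carries no token, follow the rotations until [x] or [u] receives one for the
    first time: at this moment the other vertex still has its original
    [F]-neighbours, and the same contradiction arises with it as pivot. *)
Lemma inner0_end x u : x \in inner0 -> u \in inner0 -> e x u -> degree F u < 2.
Proof.
rewrite !inE => /and3P[xW /eqP fx /eqP cx] /and3P[uW /eqP fu /eqP cu] xu.
have [[lF _] cF] := st; have [sF _ d2 _] := linear_forestP _ _ lF.
rewrite ltnNge; apply/negP => du; have {}du : degree F u = 2 by have := d2 u;
  lia.
have dx : degree F x = 2.
  apply/eqP; rewrite eqn_leq d2 leqNgt; apply/negP => dx.
  have t : 0 < tokens c F x by rewrite /tokens cx; lia.
  have [y uy yS] := token_nbr_internal sym_e irr_e st t xu du.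
  by rewrite (degree_in0 fu yS) in uy.
move: xW => /existsP[H /andP[FH t]]; move: t.
pose same G w := forall z, adj G w z = adj F w z.
have dsame G w : same G w -> degree G w = degree F w.
  by move=> h; apply: eq_card => z; rewrite !inE h.
suff [hx _] : same H x /\ same H u by rewrite /tokens (dsame _ _ hx) dx; lia.
(* Neither [x] nor [u] is involved in a rotation step. *)
move: H FH; apply: connect_rotation_ind => // H H' FH s [hx hu].
have stH := admissible_reach irr_e st FH.
have FH' := connect_trans FH (connect1 s).
have [v [p [y [[tv _ py ty] E]]]] := rotation_step_adj s stH.
have yS : y \in W := token_site FH' ty.
have ndg w : degree F w = 2 -> same H w -> w != v.
  by move=> dw /dsame hw; apply: contraTneq tv => <-; rewrite /tokens hw dw;
    lia.
have np w : degree_in (adj F) W w = 0 -> same H w -> w != p.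
  move=> fw hw; apply: contraTneq py => <-.
  by rewrite hw (degree_in0 fw yS).
have keep w : degree F w = 2 -> degree_in (adj F) W w = 0 -> same H w -> w != y -> same H' w.
  move=> dw fw hw nw z; rewrite E !xpair_eqE.
  by rewrite (negPf (ndg _ dw hw)) (negPf (np _ fw hw)) (negPf nw) /= hw.
have nend a b : e a b -> degree F b = 2 -> degree_in (adj F) W b = 0 -> same H b -> a != y.
  move=> ab db fb hb; apply/negP => /eqP Ey; rewrite -{}Ey in ty keep.
  have ba : b != a by rewrite eq_sym (e_irr irr_e ab).
  have hb' := keep _ db fb hb ba.
  have db' : degree H' b = 2 by rewrite (dsame _ _ hb').
  have [z bz zS] := token_nbr_internal sym_e irr_e (admissible_reach irr_e st FH') ty ab db'.
  by move: bz; rewrite hb' (degree_in0 fb (subsetP (sites_reach FH') _ zS)).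
split; apply: keep => //; first exact: (nend _ _ xu).
by apply: (nend _ x) => //; rewrite sym_e.
Qed.

(** Adjacent vertices of [inner0] are the two ends of a path of [F]. *)
Lemma inner0_nbhd x : x \in inner0 -> degree_in e inner0 x <= 1.
Proof.
move=> xB; apply/card_le1_eqP => u1 u2;
  rewrite 2!inE => /andP[B1 e1] /andP[B2 e2].
have [mF _] := st; have [sF _ d2 _] := linear_forestP _ _ mF.1.
have e1' : e u1 x by rewrite sym_e.
have dx := inner0_end B1 xB e1'.
have d1 := inner0_end xB B1 e1; have d2' := inner0_end xB B2 e2.
apply: esym;
  apply: (three_ends d2 sF dx d1 d2' (e_irr irr_e e1) (e_irr irr_e e2)).
  exact: (ends_connected sym_e mF).
exact: (ends_connected sym_e mF).
Qed.

(** The pairs of adjacent vertices the second of which is in [W] are counted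
    separately for a first vertex outside [W] ([out]) and in [W] ([inn]). *)
Lemma no_violation : False.
Proof.
have [mF cF] := st; have [sF _ d2 _] := linear_forestP _ _ mF.1.
have toT (h : V -> nat) : \sum_x h x = \sum_(x in [set: V]) h x.
  by apply: eq_bigl => x; rewrite inE.
have eS : \sum_x degree_in e W x = #|W| * d.
  rewrite toT degree_in_swap // -sum_nat_const.
  apply: eq_bigr => v _; rewrite -(reg_e v); apply: eq_card => y.
  by rewrite !inE.
have fS : \sum_x degree_in (adj F) W x + \sum_(v in W) c v + m = 2 * #|W|.
  rewrite toT degree_in_swap // /m (total_tokens_sites st) // -!big_split /=.
  rewrite mulnC -sum_nat_const; apply: eq_bigr => v _.
  rewrite /tokens; have -> : degree_in (adj F) [set: V] v = degree F v.
    by apply: eq_card => y; rewrite !inE.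
  by have := cF v; lia.
(* [f] counts the neighbours in [W] along [F], and [g] those in the graph. *)
pose f x := degree_in (adj F) W x; pose g x := degree_in e W x.
have out : \sum_(x | x \notin W) 2 * g x <= \sum_(x | x \notin W) d * f x + 2 * #|W|.
  have h0 : \sum_(x in outer0) g x <= #|W|.
    rewrite degree_in_swap // -[leqRHS]muln1 -sum_nat_const;
      apply: leq_sum => v.
    exact: outer0_nbhd.
  apply: leq_trans (_ : \sum_(x | x \notin W) d * f x +
                        2 * \sum_(x in outer0) g x <= _); last first.
    by rewrite leq_add2l leq_mul2l.
  rewrite [\sum_(x in outer0) _](_ : _ =
      \sum_(x | x \notin W) (if f x == 0 then g x else 0)); last first.
    by rewrite -big_mkcondr; apply: eq_bigl => x; rewrite !inE.
  rewrite big_distrr -big_split /=; apply: leq_sum => x xW.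
  have gd : g x <= d := degree_in_regular _ _.
  have [f0|f0] := eqVneq (f x) 0; first by lia.
  have [g2|g2] := leqP (2 * g x) d; first by nia.
  have : 2 <= f x := degree_outside xW g2.
  nia.
have inn : \sum_(x in W) 2 * g x <= 2 * #|W| + \sum_(x in W) d * (f x + c x).
  have BW : inner0 \subset W by apply/subsetP => x; rewrite inE => /andP[].
  pose G := W :\: inner0.
  have GW : G \subset W by apply: subsetDl.
  have split_ (h : V -> nat) : \sum_(x in W) h x = \sum_(x in inner0) h x + \sum_(x in G) h x.
    by rewrite (big_setID inner0) /= (setIidPr BW).
  (* The edges from [inner0] to the rest [G] of [W] are counted from [G]. *)
  have gB : \sum_(x in inner0) g x <= #|inner0| + \sum_(x in G) g x.
    apply: leq_trans (_ : \sum_(x in inner0) degree_in e inner0 x +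
                          \sum_(x in inner0) degree_in e G x <= _).
      rewrite -big_split /=; apply: leq_sum => x _.
      by rewrite /g !degree_inE split_.
    apply: leq_add.
      rewrite -[leqRHS]muln1 -sum_nat_const; apply: leq_sum => x;
        exact: inner0_nbhd.
    rewrite degree_in_swap //; apply: leq_sum => x _; exact: degree_in_le.
  have gG : 4 * \sum_(x in G) g x <= \sum_(x in G) d * (f x + c x).
    rewrite big_distrr /=; apply: leq_sum => x; rewrite inE => /andP[xB xW].
    have := degree_inside xW; rewrite -/(g x).
    suff : 0 < f x + c x by nia.
    by move: xB; rewrite inE xW /= negb_and -/(f x) -!lt0n; lia.
  rewrite -big_distrr /= (split_ g) (split_ (fun x => d * (f x + c x))).
  by have := subset_leq_card BW; lia.
have := eS; rewrite (bigID (mem W)) /= => eS'.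
have := fS; rewrite (bigID (mem W)) /= => fS'.
move: out inn; rewrite -!big_distrr /= big_split /= -/f -/g => out inn.
have {}fS' : \sum_(i in W) f i + \sum_(i | i \notin W) f i + \sum_(v in W) c v + m
  = 2 * #|W| := fS'.
have {}eS' : \sum_(i in W) g i + \sum_(i | i \notin W) g i = #|W| * d := eS'.
have := congr1 (muln d) fS'; move: out inn eS' big.
move: #|W| (\sum_(i in W) f i) (\sum_(i | i \notin W) f i) (\sum_(v in W) c v).
move: (\sum_(i in W) g i) (\sum_(i | i \notin W) g i) => a b w p q r.
by rewrite !mulnDr; lia.
Qed.

End Violation.

Lemma total_tokens_le c F :
  admissible c F -> total_tokens c F * d <= 8 * #|sites c F|.
Proof.
have [n] := ubnP #|sites c F|; elim: n c F => // n IHn c F /ltnSE-hn st.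
rewrite leqNgt; apply/negP => big; apply: (no_violation st _ big).
by move=> c' F' st' lt; apply: IHn => //; apply: leq_trans lt hn.
Qed.

Lemma exists_max_linear_forest : exists F, max_linear_forest e F.
Proof.
have l0 : linear_forest e set0.
  apply/linear_forestP; split.
  - by move=> x y; rewrite /adj !inE.
  - by move=> x y; rewrite /adj inE.
  - move=> x; rewrite /degree (_ : [set _ | _] = set0) ?cards0 //.
    by apply/setP=> y; rewrite /adj !inE.
  - by apply/acyclicP => x y; rewrite /adj inE.
case: (@arg_maxnP _ set0 (linear_forest e) (fun F => #|F|) l0) => F lF maxF.
by exists F.
Qed.

(** As [#|F|] is twice the number of edges, [2 * #|V| - #|F|] is twice the
    number of components of [F]. *)
Lemma linear_forest_few_components :
  exists2 F, linear_forest e F & (2 * #|V| - #|F|) * d <= 8 * #|V|.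
Proof.
have [F mF] := exists_max_linear_forest; exists F; first exact: mF.1.
have st : admissible (fun=> 0) F.
  by split=> // v; rewrite addn0; have [_ _ + _] := linear_forestP _ _ mF.1;
    apply.
have := total_tokens_le st; have := total_tokens_eq st;
  rewrite big1_eq addn0 => <-.
rewrite addnK => /leq_trans; apply; rewrite leq_mul2l /=; exact: max_card.
Qed.

End Counting.

(** * Decomposing a linear forest into paths *)

Section PathDecomposition.
Variables (V : finType) (e : rel V).
Hypotheses (sym_e : symmetric e) (irr_e : irreflexive e).
Implicit Types (F : {set V * V}) (p q : seq V).

Lemma sorted_rev_sym (r : rel V) p :
  symmetric r -> sorted r (rev p) = sorted r p.
Proof. by move=> sr; rewrite rev_sorted; apply: eq_sorted => x y;
  rewrite sr. Qed.

(** A path of [F] can be traversed so as to end at a given vertex of degree at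
    most one. *)
Lemma sorted_end F p x : symmetric (adj F) -> sorted (adj F) p -> uniq p ->
  x \in p -> degree F x <= 1 -> exists2 q, perm_eq (rcons q x) p & sorted (adj F) (rcons q x).
Proof.
move=> sF + + xp; case/splitPr: xp => p1 p2 sp up dx.
case/lastP: p1 sp up => [|p1 y] /= sp up.
  exists (rev p2); first by rewrite -rev_cons perm_rev.
  by rewrite -rev_cons sorted_rev_sym.
case: p2 sp up => [|z p2] sp up.
  by exists (rcons p1 y); rewrite -cats1.
have xy : adj F x y.
  by move: sp; rewrite sF;
    rewrite cat_rcons sorted_cat_cons => /andP[_ /andP[]].
have xz : adj F x z.
  by move: sp; rewrite sorted_cat_cons => /andP[_ /andP[]].
have yz : y != z.
  apply: contraTneq up => ->; rewrite cat_uniq /= !mem_rcons !inE eqxx.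
  by rewrite orbT !andbF.
have := @leq_uniq_degree _ F x [:: y; z];
  rewrite /= inE yz xy xz => /(_ isT isT).
by move/leq_trans/(_ dx).
Qed.

Lemma sorted_connect F p x y : symmetric (adj F) -> sorted (adj F) p ->
  x \in p -> y \in p -> connect (adj F) x y.
Proof.
case: p => // z p sF /path_connect h xp yp.
apply: connect_trans (h y yp); rewrite (sym_connect_sym sF); exact: h.
Qed.

(** By induction on the number of edges: the ends of a deleted edge are ends of
    two different paths of the remaining forest. *)
Lemma path_decomposition F : linear_forest e F -> exists L : seq (seq V),
  [/\ perm_eq (flatten L) (enum V), [::] \notin L,
      all (sorted (adj F)) L & 2 * size L + #|F| = 2 * #|V|].
Proof.
have [n] := ubnP #|F|; elim: n F => // n IH F ltF lF.
have [->|[[x y] xy]] := set_0Vmem F.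
  exists [seq [:: x] | x <- enum V]; split.
  - by rewrite (_ : flatten _ = enum V) //; elim: (enum V) => //= x s ->.
  - by apply/mapP => -[].
  - by apply/allP => p /mapP[x _ ->].
  by rewrite size_map cards0 addn0 -cardE cardT.
have [sF _ d2 /acyclicP aF] := linear_forestP _ _ lF.
have nxy := adj_irr irr_e lF xy.
have cF := card_del_edge sF nxy xy.
have dD z := degree_del_edge z sF nxy xy.
have dx : degree (del_edge F x y) x <= 1 by have := dD x; have := d2 x;
  rewrite eqxx; clear; lia.
have dy : degree (del_edge F x y) y <= 1 by have := dD y; have := d2 y;
  rewrite eqxx; clear; lia.
have ltF' : #|del_edge F x y| < n by lia.
have [L [pL nL /allP sL szL]] := IH _ ltF' (linear_forest_del_edge x y lF).
have sD := sym_del_edge x y sF.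
have uL : uniq (flatten L) by rewrite (perm_uniq pL) enum_uniq.
have inL z : exists2 p, p \in L & z \in p.
  by apply/flattenP; rewrite (perm_mem pL) mem_enum.
have [p pinL xp] := inL x; have [q qinL yq] := inL y.
have npq : q != p.
  apply: contraNneq (aF _ _ xy) => E; rewrite E in yq.
  exact: sorted_connect (sL _ pinL) xp yq.
have perL : perm_eq L [:: p, q & rem q (rem p L)].
  apply: (perm_trans (perm_to_rem pinL)); rewrite perm_cons; apply: perm_to_rem.
  by move: (perm_mem (perm_to_rem pinL) q);
    rewrite qinL inE (negPf npq) /= => <-.
move: (rem q _) perL => M perL.
have perfL := perm_flatten perL.
have := uL;
  rewrite (perm_uniq perfL) /= !cat_uniq => /and3P[up _ /and3P[uq _ _]].
have [p' pp' sp'] := sorted_end sD (sL _ pinL) up xp dx.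
have [q' qq' sq'] := sorted_end sD (sL _ qinL) uq yq dy.
have subD : subrel (adj (del_edge F x y)) (adj F) by move=> a b /adj_del_edgeW.
exists ((rcons p' x ++ y :: rev q') :: M); split.
- rewrite -(permPr pL) (permPr perfL) /= -catA; apply: perm_cat => //.
  apply: perm_cat => //; rewrite -rev_rcons.
  by rewrite perm_rev.
- rewrite inE negb_or; apply/andP; split; first by case: (p').
  apply: contra nL => h; rewrite (perm_mem perL) !inE h !orbT.
  by [].
- rewrite /=; apply/andP; split; last first.
    apply/allP => r rM; apply: (sub_sorted subD); apply: sL.
    by rewrite (perm_mem perL) !inE rM !orbT.
  have yr : y :: rev q' = rev (rcons q' y) by rewrite rev_rcons.
  have srq : sorted (adj F) (y :: rev q').
    by rewrite yr sorted_rev_sym //; apply: sub_sorted sq'.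
  rewrite cat_rcons sorted_cat_cons (sub_sorted subD sp') /=.
  exact/andP.
by move: (perm_size perL) szL cF => /= ->; clear; lia.
Qed.

End PathDecomposition.

(** * Walks, arcs and closed walks *)

Section Walks.
Variables (V : finType) (e : rel V).
Hypothesis sym_e : symmetric e.
Implicit Types (w : V * seq V) (L A C : seq (V * seq V)) (a b s t x y v : V).

(** A walk [(a, p)] visits [a] and then the vertices of [p]; its length is
    [size p]. *)
Definition wend w := last w.1 w.2.
Definition verts w := w.1 :: w.2.
Definition walk w := path e w.1 w.2.
(** The multiset of the first and last vertices of the walks in [L]. *)
Definition ends L := flatten [seq [:: w.1; wend w] | w <- L].
Definition total_length L := \sum_(w <- L) size w.2.
Definition closed_walk w := walk w && (wend w == w.1).

Definition wrev w := (wend w, rev (belast w.1 w.2)).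

Lemma walk_rev w : walk w -> walk (wrev w).
Proof.
move=> h; rewrite /walk /= rev_path; apply: sub_path h => x y /=.
by rewrite sym_e.
Qed.

Lemma verts_rev w : verts (wrev w) = rev (verts w).
Proof. by case: w => a p; rewrite /verts /= -rev_rcons -lastI. Qed.

Lemma wend_rev w : wend (wrev w) = w.1.
Proof.
rewrite /wend /= -(last_cons w.1) -/(verts (wrev w)) verts_rev.
by rewrite /verts rev_cons last_rcons.
Qed.

Lemma size_rev w : size (wrev w).2 = size w.2.
Proof. by rewrite /= size_rev size_belast. Qed.

(** Concatenation, for walks such that [w'] starts where [w] ends. *)
Definition wcat w w' := (w.1, w.2 ++ w'.2).

Lemma walk_cat w w' : wend w = w'.1 -> walk w -> walk w' -> walk (wcat w w').
Proof. by rewrite /walk /= cat_path => <- -> . Qed.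

Lemma wend_cat w w' : wend w = w'.1 -> wend (wcat w w') = wend w'.
Proof. by rewrite /wend /= last_cat => ->. Qed.

Lemma ends_cons w L : ends (w :: L) = [:: w.1, wend w & ends L].
Proof. by []. Qed.

Lemma total_length_cons w L : total_length (w :: L) = size w.2 + total_length L.
Proof. by rewrite /total_length big_cons. Qed.

Definition covered L v := exists2 w, w \in L & v \in verts w.

Lemma covered_cons w L v : covered (w :: L) v <-> v \in verts w \/ covered L v.
Proof.
split=> [[w' ]|[vw|[w' wL vw]]].
- by rewrite inE => /orP[/eqP->|wL] vw; [left|right; exists w'].
- by exists w; rewrite ?mem_head.
by exists w' => //; rewrite inE wL orbT.
Qed.

(** Extracts a walk with end [s], oriented so that it ends at [s]. *)
Lemma pick_end L s : all walk L -> s \in ends L ->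
  exists w L', [/\ walk w /\ wend w = s, all walk L',
    perm_eq (ends L) (s :: w.1 :: ends L'),
    total_length L = size w.2 + total_length L' &
    forall v, covered L v -> v \in verts w \/ covered L' v].
Proof.
elim: L => // w L IH /= /andP[ww wL];
  rewrite ends_cons !inE => /or3P[/eqP->|/eqP->|sL].
- exists (wrev w), L; split=> //.
  + by split; [apply: walk_rev|apply: wend_rev].
  + by rewrite total_length_cons size_rev.
  by move=> v /covered_cons; rewrite verts_rev mem_rev.
- exists w, L; split=> //.
  + by rewrite (perm_catCA [:: _] [:: _]).
  + by rewrite total_length_cons.
  by move=> v /covered_cons.
have [w' [L' [[ww' es] wL' pL szL cL]]] := IH wL sL.
exists w', (w :: L'); split=> //=.
- by rewrite ww.
- rewrite ends_cons -(perm_cat2l [:: w.1; wend w]) in pL *.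
  apply: (perm_trans pL).
  by rewrite (perm_catCA [:: w.1; wend w] [:: s; w'.1] (ends L')).
- by rewrite !total_length_cons szL; clear; lia.
move=> v /covered_cons[vw|/cL[vw|vL]]; [right|by left|right].
  by apply/covered_cons; left.
by apply/covered_cons; right.
Qed.

Lemma mem_wcat w w' v : wend w = w'.1 ->
  v \in verts (wcat w w') = (v \in verts w) || (v \in verts w').
Proof.
move=> E; rewrite /verts /= !inE mem_cat -E.
have := mem_last w.1 w.2; rewrite -/(wend w) inE.
have [->|_] := eqVneq v (wend w); last by rewrite orbA.
by move=> /orP[->|->]; rewrite ?orbT.
Qed.

(** Walks and arcs with the same ends close up: join the walks along one arc at
    a time; a walk whose two ends are joined is complete. *)
Lemma close_up L A : all walk L -> all walk A -> perm_eq (ends L) (ends A) ->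
  exists C, [/\ all closed_walk C, forall w, w \in C -> w.1 \in ends A,
    forall v, covered L v -> covered C v &
    total_length C = total_length L + total_length A].
Proof.
elim: A L => [|r A IH] L wL /= => [_|/andP[wr wA]] pL.
  exists [::]; split=> //.
    case: L wL pL => [|w L] // _; rewrite ends_cons => /perm_size //.
  case: L wL pL => [|w L] // _; last by rewrite ends_cons => /perm_size.
  by rewrite /total_length !big_nil.
rewrite ends_cons in pL.
have sL : r.1 \in ends L by rewrite (perm_mem pL) inE eqxx.
have [w [L1 [[ww es] wL1 p1 sz1 c1]]] := pick_end wL sL.
have wwr : walk (wcat w r) by apply: walk_cat.
have pL1 : perm_eq (w.1 :: ends L1) (wend r :: ends A).
  by rewrite -(perm_cons r.1) -(permPl p1).
have [E|NE] := eqVneq w.1 (wend r).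
  rewrite E perm_cons in pL1.
  have [C [clC startC covC szC]] := IH _ wL1 wA pL1.
  exists (wcat w r :: C); split=> /=.
  - by rewrite clC /closed_walk wwr wend_cat //= E eqxx.
  - move=> w'; rewrite inE => /orP[/eqP-> /=|/startC h]; rewrite ends_cons !inE.
      by rewrite E eqxx orbT.
    by rewrite h !orbT.
  - move=> v /c1[vw|/covC h]; apply/covered_cons; last by right.
    by left; rewrite mem_wcat // vw.
  by rewrite !total_length_cons /= size_cat sz1 szC; clear; lia.
have tL1 : wend r \in ends L1.
  by have := perm_mem pL1 (wend r); rewrite !inE eqxx eq_sym (negPf NE).
have [w2 [L2 [[ww2 e2] wL2 p2 sz2 c2]]] := pick_end wL1 tL1.
pose w3 := wcat (wcat w r) (wrev w2).
have E3 : wend (wcat w r) = (wrev w2).1 by rewrite (wend_cat es) /= e2.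
have ww3 : walk w3 by apply: walk_cat => //; apply: walk_rev.
have pL3 : perm_eq (ends (w3 :: L2)) (ends A).
  rewrite ends_cons wend_cat // wend_rev /= -(perm_cons (wend r)) -(permPr pL1).
  rewrite (perm_catCA [:: _] [:: _]) /= perm_cons perm_sym.
  exact: p2.
have wL3 : all walk (w3 :: L2) by rewrite /= ww3.
have [C [clC startC covC szC]] := IH _ wL3 wA pL3.
exists C; split=> //.
- by move=> w' /startC h; rewrite ends_cons !inE h !orbT.
- move=> v /c1[vw|/c2[vw|h]]; apply: covC; apply/covered_cons.
  + by left; rewrite mem_wcat // mem_wcat // vw.
  + by left; rewrite mem_wcat // verts_rev mem_rev vw orbT.
  by right.
rewrite szC !total_length_cons /= !size_cat sz1 sz2 size_rev; clear; lia.
Qed.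

(** Vertices of a walk can be paired by arcs of total length at most that of
    the walk.  Induction on the walk: the occurrences of the first vertex [a]
    are paired among themselves, and if one is left over, then an arc from the
    second vertex [b] of the walk is prolonged to [a]. *)
Lemma arcs_along a p (ts : seq V) : path e a p -> {subset ts <= a :: p} ->
  ~~ odd (size ts) ->
  exists A, [/\ all walk A, perm_eq (ends A) ts & total_length A <= size p].
Proof.
have trivial_arcs k x : exists A, [/\ all walk A, ends A = nseq k.*2 x & total_length A = 0].
  elim: k => [|k [A [wA eA tA]]]; first by exists [::];
    rewrite /total_length big_nil.
  by exists ((x, [::]) :: A); rewrite total_length_cons ends_cons eA tA.
elim: p a ts => [|b p IH] a ts /=.
  move=> _ sub ev.
  have -> : ts = nseq (size ts)./2.*2 a.
    rewrite even_halfK //; apply/all_pred1P/allP => x /sub.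
    by rewrite inE => /eqP->; rewrite /= eqxx.
  have [A [wA eA tA]] := trivial_arcs (size ts)./2 a.
  by exists A; rewrite tA eA.
case/andP=> ab bp sub ev.
pose k := count_mem a ts; pose ts' := [seq t <- ts | t != a].
have pts : perm_eq ts (nseq k a ++ ts').
  rewrite -(perm_filterC (pred1 a) ts) perm_sym.
  have -> : nseq k a = [seq t <- ts | pred1 a t].
    rewrite /k -size_filter; apply/esym/all_pred1P/filter_all.
  by [].
have sub' : {subset ts' <= b :: p}.
  by move=> t; rewrite mem_filter => /andP[nt /sub]; rewrite inE (negPf nt).
have [A0 [wA0 eA0 tA0]] := trivial_arcs k./2 a.
have sz : size ts = k + size ts' by rewrite (perm_size pts) size_cat size_nseq.
have [ok|ek] := boolP (odd k).
  have sub'' : {subset b :: ts' <= b :: p}.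
    by move=> t; rewrite inE => /orP[/eqP->|/sub'//]; rewrite mem_head.
  have ev'' : ~~ odd (size (b :: ts')) by move: ev; rewrite sz oddD ok.
  have [A [wA pA tA]] := IH _ _ bp sub'' ev''.
  have bA : b \in ends A by rewrite (perm_mem pA) mem_head.
  have [w [A' [[ww ew] wA' p' sz' _]]] := pick_end wA bA.
  pose w' := wcat w (b, [:: a]).
  exists (w' :: A0 ++ A'); split.
  - rewrite /= all_cat wA0 wA' !andbT; apply: walk_cat => //.
    by rewrite /walk /= sym_e ab.
  - have {}pA : perm_eq (w.1 :: ends A') ts'.
      by rewrite -(perm_cons b) -(permPl p').
    rewrite ends_cons wend_cat // (permPr pts) /ends map_cat flatten_cat.
    rewrite -!/(ends _) eA0.
    have -> : nseq k a = a :: nseq k./2.*2 a by rewrite -{1}(odd_double_half k) ok.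
    rewrite (perm_catCA [:: _] [:: _]) /= perm_cons.
    by rewrite -cat1s perm_catCA perm_cat2l.
  rewrite total_length_cons /total_length big_cat -!/(total_length _) tA0 /=.
  by rewrite size_cat /=; move: tA sz'; clear; lia.
have ev' : ~~ odd (size ts') by move: ev; rewrite sz oddD (negPf ek).
have [A [wA pA tA]] := IH _ _ bp sub' ev'.
exists (A0 ++ A); split.
- by rewrite all_cat wA0.
- rewrite (permPr pts) /ends map_cat flatten_cat -!/(ends _) eA0.
  by rewrite even_halfK // perm_cat2l.
by rewrite /total_length big_cat /= -!/(total_length _) tA0 add0n ltnW.
Qed.

(** A closed walk [c] that starts on a closed walk [w] can be inserted in it. *)
Lemma splice w c : closed_walk w -> closed_walk c -> c.1 \in verts w ->
  exists w', [/\ closed_walk w', size w'.2 = size w.2 + size c.2 &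
    forall v, (v \in verts w) || (v \in verts c) -> v \in verts w'].
Proof.
case: w c => [a p] [b q] /andP[/= ww /eqP ew] /andP[/= wc /eqP ec].
rewrite /verts /= => bp; case/splitPl: bp ww ew => p1 p2 Eb.
rewrite /walk /wend /= in wc ec *.
rewrite cat_path last_cat Eb => /andP[ww1 ww2] ew.
exists (a, p1 ++ q ++ p2); split.
- by rewrite /closed_walk /walk /wend /= !cat_path !last_cat Eb ec ww1 wc ww2 ew /=.
- by rewrite /= !size_cat; lia.
move=> v; rewrite !inE !mem_cat.
have : b \in a :: p1 by rewrite -Eb mem_last.
rewrite inE; have [->|_] := eqVneq v b; last first.
  by case: (v == a); case: (v \in p1); case: (v \in p2); case: (v \in q).
by case/orP=> ->; rewrite ?orbT.
Qed.

Lemma splice_all w C : closed_walk w -> all closed_walk C ->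
  (forall c, c \in C -> c.1 \in verts w) ->
  exists w', [/\ closed_walk w', size w'.2 = size w.2 + total_length C,
    {subset verts w <= verts w'} & forall v, covered C v -> v \in verts w'].
Proof.
elim: C w => [|c C IH] w cw /=.
  by exists w; split=> //; [rewrite /total_length big_nil addn0|move=> v []].
case/andP=> cc cC sub.
have [w1 [cw1 sz1 sub1]] := splice cw cc (sub c (mem_head _ _)).
have sub' c' : c' \in C -> c'.1 \in verts w1.
  by move=> h; apply: sub1; rewrite sub // inE h orbT.
have [w2 [cw2 sz2 sub2 cov2]] := IH _ cw1 cC sub'.
exists w2; split=> //; first by rewrite sz2 sz1 total_length_cons; lia.
  by move=> v h; apply: sub2; apply: sub1; rewrite h.
move=> v /covered_cons[h|/cov2//]; apply: sub2; apply: sub1.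
by rewrite h orbT.
Qed.

End Walks.

(** * A short tour of a connected regular graph *)

Section Backbone.
Variables (V : finType) (e : rel V) (d : nat).
Hypotheses (sym_e : symmetric e) (irr_e : irreflexive e).
Hypothesis reg_e : forall x, #|[set y | e x y]| = d.
Hypothesis conn_e : forall x y, connect e x y.
Implicit Types (C : {set V}) (a b s t u v x y : V).

(** Vertices at distance at most one, respectively two. *)
Definition near1 x y := (x == y) || e x y.
Definition near2 x y := [exists z, near1 x z && near1 z y].

Lemma near1_sym x y : near1 x y = near1 y x.
Proof. by rewrite /near1 eq_sym sym_e. Qed.

Lemma near2_sym x y : near2 x y = near2 y x.
Proof. by apply: eq_existsb => z; rewrite andbC near1_sym (near1_sym x). Qed.

(** The vertices of [C] are pairwise at distance at least three. *)
Definition separated C := forall x y, x \in C -> y \in C -> near2 x y -> x = y.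

(** Closed neighbourhoods have [d.+1] vertices, and those of the vertices of [C]
    are disjoint. *)
Lemma separated_card C : separated C -> #|C| * d.+1 <= #|V|.
Proof.
move=> sepC; have sr : symmetric near1 by move=> x y; apply: near1_sym.
have <- : \sum_(x in C) degree_in near1 [set: V] x = #|C| * d.+1.
  rewrite -sum_nat_const; apply: eq_bigr => x _; rewrite /degree_in -(reg_e x).
  rewrite (_ : [set y in _ | _] = x |: [set y | e x y]).
    by rewrite cardsU1 inE irr_e.
  by apply/setP => y; rewrite !inE /near1 eq_sym.
rewrite degree_in_swap // -cardsT -[leqRHS]muln1 -sum_nat_const.
apply: leq_sum => z _; apply/card_le1_eqP => x y.
rewrite !inE => /andP[xC zx] /andP[yC zy]; apply/esym/sepC => //.
by apply/existsP; exists z; rewrite near1_sym zx.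
Qed.

(** A closed walk through a separated set that dominates the graph at distance
    two.  It grows by detours of length six to vertices at distance three. *)
Lemma backbone (v0 : V) : exists (C : {set V}) w,
  [/\ closed_walk e w, separated C, {subset C <= verts w},
      size w.2 <= 6 * #|C| & forall v, exists2 c, c \in C & near2 c v].
Proof.
suff grow n C w : #|V| - #|C| < n -> C != set0 -> closed_walk e w ->
    separated C -> {subset C <= verts w} -> size w.2 <= 6 * #|C| ->
    exists (C : {set V}) w, [/\ closed_walk e w, separated C, {subset C <= verts w},
      size w.2 <= 6 * #|C| & forall v, exists2 c, c \in C & near2 c v].
  apply: (grow _ [set v0] (v0, [::]) (leqnn _)).
  - by apply/set0Pn; exists v0; rewrite inE.
  - by rewrite /closed_walk /walk /wend /= eqxx.
  - by move=> x y; rewrite !inE => /eqP-> /eqP->.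
  - by move=> x; rewrite /verts !inE.
  by [].
elim: n C w => // n IH C w ltn C0 cw sepC subC szw.
pose D := [set v | [exists c in C, near2 c v]].
have [full|] := boolP [forall v, v \in D].
  exists C, w; split=> // v.
  by have := forallP full v; rewrite inE => /exists_inP.
rewrite negb_forall => /existsP[v1 v1D].
have near_refl x : near1 x x by rewrite /near1 eqxx.
have CD c : c \in C -> c \in D.
  move=> cC; rewrite inE; apply/exists_inP; exists c => //.
  by apply/existsP; exists c; rewrite !near_refl.
(* By connectedness an edge leaves the set [D] of dominated vertices. *)
have [u [v [uv uD vD]]] : exists u v, [/\ e u v, u \in D & v \notin D].
  have [c cC] := set0Pn _ C0.
  have [|noexit] := boolP [exists u, exists v, [&& e u v, u \in D & v \notin D]].
    by case/existsP=> u /existsP[v /and3P[h1 h2 h3]]; exists u, v.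
  have cl : closed e (mem D).
    apply: (intro_closed (sym_connect_sym sym_e)) => x y xy xD.
    apply: contraNT noexit => yD; apply/existsP; exists x; apply/existsP.
    by exists y; rewrite xy xD.
  by have := closed_connect cl (conn_e c v1); rewrite /= (CD _ cC) (negPf v1D).
have notnear c : c \in C -> near2 c v = false.
  by move=> cC; apply: contraNF vD => h; rewrite inE; apply/exists_inP;
    exists c.
have := uD; rewrite inE => /exists_inP[c cC /existsP[b /andP[cb bu]]].
have far1 : near1 c u -> False.
  move=> cu; have /negP := negbT (notnear c cC); apply; apply/existsP; exists u.
  by rewrite cu /near1 uv orbT.
have ecb : e c b.
  by case/orP: cb => // /eqP E; case: far1; rewrite E.
have ebu : e b u.
  by case/orP: bu => // /eqP E; case: far1; rewrite -E /near1 ecb orbT.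
have cdet : closed_walk e (c, [:: b; u; v; u; b; c]).
  by rewrite /closed_walk /walk /wend /= ecb ebu uv sym_e uv sym_e ebu sym_e ecb eqxx.
have [w' [cw' sz' sub']] := splice cw cdet (subC _ cC).
have vC : v \notin C by apply: contra vD; apply: CD.
have cardC : #|v |: C| = #|C|.+1 by rewrite cardsU1 vC.
apply: (IH (v |: C) w') => //.
- have := max_card (mem (v |: C)); move: ltn; rewrite cardC.
  by move: #|V| #|C|; clear; lia.
- by apply/set0Pn; exists v; rewrite setU11.
- move=> x y; rewrite !inE => /orP[/eqP->|xC] /orP[/eqP->|yC] //.
  + by rewrite near2_sym notnear.
  + by rewrite notnear.
  exact: sepC.
- move=> x; rewrite !inE => /orP[/eqP->|xC]; apply: sub'.
    by rewrite orbC /verts /= !inE eqxx !orbT.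
  by rewrite subC.
by rewrite sz' cardC /=; move: szw; clear; lia.
Qed.

(** Each further vertex costs a detour of length at most four. *)
Lemma visit_all C w (ts : seq V) : closed_walk e w -> {subset C <= verts w} ->
  (forall v, exists2 c, c \in C & near2 c v) ->
  exists w', [/\ closed_walk e w', {subset ts <= verts w'} &
    size w'.2 <= size w.2 + 4 * size ts] /\ {subset verts w <= verts w'}.
Proof.
move=> cw subC domC; elim: ts => [|t ts [w' [[cw' subt sz'] sub']]].
  by exists w; rewrite muln0 addn0; split=> [|x //]; split.
have [c cC /existsP[b /andP[cb bt]]] := domC t.
have [q [cq tq szq]] : exists q, [/\ closed_walk e (c, q), t \in c :: q & size q <= 4].
  case/orP: cb => [/eqP Eb|ecb]; case/orP: bt => [/eqP Et|ebt].
  - by exists [::]; rewrite Eb Et /closed_walk /wend /= eqxx mem_head.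
  - exists [:: t; c]; rewrite /closed_walk /walk /wend /= Eb ebt sym_e ebt eqxx.
    by rewrite !inE eqxx orbT.
  - exists [:: t; c];
      rewrite /closed_walk /walk /wend /= -Et ecb sym_e ecb eqxx.
    by rewrite !inE eqxx orbT.
  exists [:: b; t; b; c]; rewrite /closed_walk /walk /wend /= ecb ebt sym_e ebt.
  by rewrite sym_e ecb eqxx !inE eqxx !orbT.
have [w2 [cw2 sz2 sub2]] := splice cw' cq (sub' _ (subC _ cC)).
exists w2; split; last by move=> x xw; apply: sub2; rewrite sub'.
split=> //; last by rewrite sz2 /=; move: sz' szq; clear; lia.
move=> x; rewrite inE => /orP[/eqP->|/subt h]; apply: sub2; last by rewrite h.
by rewrite orbC /verts tq.
Qed.

Lemma path_walks (L : seq (seq V)) (r : rel V) : subrel r e ->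
  [::] \notin L -> all (sorted r) L -> exists W : seq (V * seq V),
  [/\ all (walk e) W, size W = size L,
      total_length W + size L = size (flatten L) &
      forall v, v \in flatten L -> covered W v].
Proof.
move=> re; elim: L => [|[|a p] L IH] //=.
  by move=> _ _; exists [::]; rewrite /total_length big_nil.
rewrite inE negb_or => /andP[_ nL] /andP[sp sL].
have [W [wW szW tW cW]] := IH nL sL.
exists ((a, p) :: W); split=> /=.
- by rewrite wW andbT; apply: sub_path sp.
- by rewrite szW.
- by rewrite total_length_cons size_cat -tW /=; clear; lia.
move=> v; rewrite -cat_cons mem_cat => /orP[h|/cW h]; apply/covered_cons.
  by left.
by right.
Qed.

Lemma size_ends (W : seq (V * seq V)) : size (ends W) = 2 * size W.
Proof. by elim: W => // w W IH; rewrite ends_cons /= IH mulnS. Qed.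

(** If the forest has [k] paths, [w] is the backbone and [w1] its extension to
    the ends of the paths, then [size w.2 <= 6 * #|C|] and
    [size w1.2 <= size w.2 + 8 * k]; the paths have total length [#|V| - k] and
    the arcs are no longer than [w1].  The constant is [76 = 12 + 16 * 4], since
    [#|C| * d <= #|V|] and [k * d <= 4 * #|V|]. *)
Lemma short_tour (v0 : V) : exists (x : V) (p : seq V),
  [/\ path e x p, last x p = x, forall v, v \in x :: p &
      size p * d <= #|V| * d + 76 * #|V|].
Proof.
have [F lF hF] := linear_forest_few_components sym_e irr_e reg_e.
have [_ Fe _ _] := linear_forestP _ _ lF.
have [L [pL nL sL szL]] := path_decomposition irr_e lF.
have [W [wW szW tW cW]] := path_walks (Fe : subrel _ _) nL sL.
have [C [w [cw sepC subC szw domC]]] := backbone v0.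
have cardC := separated_card sepC.
have [w1 [[cw1 sub1 sz1] _]] := visit_all (ends W) cw subC domC.
have ev : ~~ odd (size (ends W)) by rewrite size_ends oddM.
have [A [wA pA tA]] := arcs_along sym_e (proj1 (andP cw1)) sub1 ev.
rewrite perm_sym in pA.
have [Cs [clC startC covC szC]] := close_up sym_e wW wA pA.
have startC' c : c \in Cs -> c.1 \in verts w1.
  by move=> /startC h; apply: sub1; rewrite (perm_mem pA).
have [w2 [cw2 sz2 sub2 cov2]] := splice_all cw1 clC startC'.
have [ww2 /eqP ew2] := andP cw2.
exists w2.1, w2.2; split=> //.
  move=> v; apply: cov2; apply: covC; apply: cW.
  by rewrite (perm_mem pL) mem_enum.
have szF : size (flatten L) = #|V| by rewrite (perm_size pL) -cardE cardT.
rewrite size_ends szW in sz1; rewrite szF in tW.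
rewrite sz2 szC.
move: szw cardC sz1 tA tW szL hF;
  move: (total_length W) (total_length A) (size L).
move: (size w1.2) (size w.2) #|F| #|V| #|C|; clear => a b f n c t r k.
nia.
Qed.

End Backbone.

Local Open Scope ring_scope.

Theorem corollary1p5 (R : realType) :
  exists K : R, 0 < K /\
    forall d n : nat, (1 <= d)%N -> (1 <= n)%N ->
    forall (V : finType) (e : rel V),
      simple_graph e -> #|V| = n -> connected_graph e -> regular_graph e d ->
      exists (x : V) (p : seq V),
        is_tour e x p /\ (size p)%:R <= (1 + K / d%:R) * n%:R.
Proof.
exists 76%:R; split; first by rewrite ltr0n.
move=> d n d0 n0 V e [sym_e irr_e] cardV conn_e reg_e.
have /card_gt0P[v0 _] : (0 < #|V|)%N by rewrite cardV.
have [x [p [px lx cov le_p]]] := short_tour sym_e irr_e reg_e conn_e v0.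
exists x, p; split; first by split.
have dR : (0 : R) < d%:R by rewrite ltr0n.
rewrite -(ler_pM2r dR) mulrAC mulrDl mul1r divfK ?gt_eqF // -natrD -!natrM.
by rewrite ler_nat mulnDl [(d * n)%N]mulnC -cardV.
Qed.
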